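(* Consider the linear program (SF-DOI stabilized set-covering problem) $$\min_{\theta,\omega,\xi}\ \sum_{l\in\Omega}c_l\theta_l+\sum_{s\in\mathcal S}\rho_s\omega_s-\sum_{u\in N,\ \sigma\in\Lambda_u}\sigma\,\xi_{u\sigma}$$ subject to $$\sum_{l\in\Omega}a_{ul}\theta_l+\sum_{s\in\mathcal S^+_u}\omega_s-\sum_{s\in\mathcal S^-_u}\omega_s-\sum_{\sigma\in\Lambda_u}\xi_{u\sigma}\ge 1\quad(u\in N),$$ $$\xi_{u\sigma}-\sum_{l\in\Omega}\beta_{ul\sigma}\theta_l\le 0\quad(u\in N,\ \sigma\in\Lambda_u),$$ $$\theta_l\ge 0\quad(l\in\Omega),\qquad \omega_s\ge 0\quad(s\in\mathcal S),\qquad \xi_{u\sigma}\ge 0\quad(u\in N,\ \sigma\in\Lambda_u),$$ where $N,\Omega,a,c,\mathcal S,\rho,\Lambda_u,\beta$ are as described in the context. This problem admits an optimal solution $(\theta^*,\omega^*,\xi^* )$ such that $\omega^*_s=0$ for every $s\in\mathcal S$ and $\xi^*_{u\sigma}=0$ for every $u\in N$, $\sigma\in\Lambda_u$.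
   Context: $N$ is a set of items to be covered and $\Omega$ is the set of all feasible columns (typically exponentially large in the size of the input); $\Omega_R\subset\Omega$ is the restricted set of columns considered at a given time in column generation. Each column $l\in\Omega$ has a cost $c_l$, and for $u\in N$, $a_{ul}\in\{0,1\}$ equals $1$ if column $l$ covers item $u$ and $0$ otherwise (a column covers an item at most once). Write $N(l)=\{u\in N: a_{ul}=1\}$. Swaps and penalties. For an ordered pair $s=(u,v)\in N\times N$ with $u\ne v$, write $s^-=u$, $s^+=v$, and let $\Omega(s)=\{l\in\Omega: a_{ul}=1,\ a_{vl}=0\}$. For $l\in\Omega(s)$, $swap(l,s)$ denotes the column constructed from $l$ by swapping $u$ for $v$ (so it covers $v$ instead of $u$). $\mathcal S$ is a set of such ordered pairs, and $(\rho_s)_{s\in\mathcal S}$ are real numbers, such that: (i) for every $s\in\mathcal S$ and every $l\in\Omega(s)$, the column $swap(l,s)$ also lies in $\Omega$; (ii) for every $s\in\mathcal S$, $\rho_s\ge\max\{c_{l'}-c_l: l\in\Omega(s),\ l'=swap(l,s)\}$; (iii) for all $s_1=(u,v)\in\mathcal S$ and $s_2=(v,w)\in\mathcal S$ with $u\ne w$, the pair $s_3=(u,w)$ is also in $\mathcal S$ and $\rho_{s_1}+\rho_{s_2}\ge\rho_{s_3}$. For $u\in N$, $\mathcal S^-_u=\{s\in\mathcal S: s^-=u\}$ and $\mathcal S^+_u=\{s\in\mathcal S: s^+=u\}$. Removals and rebates. For each $l\in\Omega$ and $u\in N$ there is a number $\sigma_{ul}\ge 0$, with $\sigma_{ul}=0$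 whenever $a_{ul}=0$. The values $(\sigma_{ul})_{u\in N,\,l\in\Omega}$ are assumed to satisfy the following property: for every column $l\in\Omega_R$ and every subset $S\subseteq N(l)$, $\sum_{u\in S}\sigma_{ul}\le c_l-c_{l'}$, where $l'=remove(l,S)\in\Omega$ is the column constructed from $l$ by removing the items in $S$. For $u\in N$, $\Lambda_u=\{\sigma_{ul}: l\in\Omega_R\}$ is the set of all values of $\sigma_{ul}$ across the restricted set $\Omega_R$. For $u\in N$, $l\in\Omega$ and $\sigma\in\Lambda_u$, $\beta_{ul\sigma}\in\{0,1\}$ equals $1$ if $\sigma_{ul}=\sigma$ and $0$ otherwise.
   Formalization: The rebate property (with remove(l,S) in Ω) is required for every column l in Ω, not only Ω_R, since the claim fails otherwise; the set-covering problem with ω=ξ=0 is also assumed feasible and bounded below, which is necessary. *)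

(* Defs.v *)
From mathcomp Require Import all_boot all_order all_algebra.
Set Implicit Arguments.
Unset Strict Implicit.
Unset Printing Implicit Defensive.
Import Order.TTheory GRing.Theory Num.Theory.
Local Open Scope ring_scope.

(* [C] is an ambient type of columns, feasible or not: [swap] and [remove]
   produce columns in [C], and their feasibility (membership in [Omega]) is a
   separate hypothesis.  Distinct columns may cover the same items. A swap [s]
   is the ordered pair (s^-, s^+) = (s.1, s.2). *)
Record sfdoi (R : realFieldType) (N C : finType) := SfDoi {
  Omega : {set C};
  OmegaR : {set C};
  covers : N -> C -> bool;
  cost : C -> R;
  swap : C -> N * N -> C;
  remove : C -> {set N} -> C;
  swaps : {set N * N};
  rho : N * N -> R;
  sigma : N -> C -> R
}.

Section SfDoi.
Variables (R : realFieldType) (N C : finType) (D : sfdoi R N C).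

Definition acoef (u : N) (l : C) : R := (covers D u l)%:R.

Definition items (l : C) : {set N} := [set u | covers D u l].

Definition swappable (s : N * N) : {set C} :=
  [set l in Omega D | covers D s.1 l && ~~ covers D s.2 l].

Definition swap_spec : Prop :=
  forall (s : N * N) (l : C), s.1 != s.2 -> l \in swappable s ->
    items (swap D l s) = s.2 |: (items l :\ s.1).

Definition remove_spec : Prop :=
  forall (l : C) (S : {set N}), l \in Omega D -> S \subset items l ->
    items (remove D l S) = items l :\: S.

Definition swaps_irreflexive : Prop :=
  forall s, s \in swaps D -> s.1 != s.2.

Definition swaps_feasible : Prop :=
  forall s l, s \in swaps D -> l \in swappable s -> swap D l s \in Omega D.

Definition rho_bound : Prop :=
  forall s l, s \in swaps D -> l \in swappable s ->
    cost D (swap D l s) - cost D l <= rho D s.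

Definition rho_triangle : Prop :=
  forall u v w, (u, v) \in swaps D -> (v, w) \in swaps D -> u != w ->
    (u, w) \in swaps D /\ rho D (u, w) <= rho D (u, v) + rho D (v, w).

Definition sigma_ge0 : Prop :=
  forall u l, l \in Omega D -> 0 <= sigma D u l.

Definition sigma_uncovered : Prop :=
  forall u l, l \in Omega D -> ~~ covers D u l -> sigma D u l = 0.

(* Requiring this only for [A := OmegaR D] does not suffice for the linear
   program over all of [Omega]: a column outside [OmegaR] can take a value in
   [Lambda u] without satisfying the inequality. *)
Definition rebate_property (A : {set C}) : Prop :=
  forall (l : C) (S : {set N}), l \in A -> S \subset items l ->
    remove D l S \in Omega D /\
    \sum_(u in S) sigma D u l <= cost D l - cost D (remove D l S).

(* Duplicate-free, so that a sum over [Lambda u] is a sum over a set. *)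
Definition Lambda (u : N) : seq R :=
  undup [seq sigma D u l | l <- enum (OmegaR D)].

Definition beta (u : N) (l : C) (sg : R) : R := (sigma D u l == sg)%:R.

(* The set-covering program before stabilization, i.e. the case omega = 0 and
   xi = 0 of the program [sf_feasible], [sf_objective]. *)
Definition sc_feasible (theta : C -> R) : Prop :=
  (forall u, \sum_(l in Omega D) acoef u l * theta l >= 1) /\
  (forall l, l \in Omega D -> 0 <= theta l).

Definition sc_objective (theta : C -> R) : R :=
  \sum_(l in Omega D) cost D l * theta l.

(* Only the values of [theta] on [Omega], of [omega] on [swaps], and of [xi u]
   on [Lambda u] are decision variables; the other values are irrelevant. *)
Definition sf_feasible
    (theta : C -> R) (omega : N * N -> R) (xi : N -> R -> R) : Prop :=
  [/\ forall u,
        \sum_(l in Omega D) acoef u l * theta l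
        + \sum_(s in swaps D | s.2 == u) omega s
        - \sum_(s in swaps D | s.1 == u) omega s
        - \sum_(sg <- Lambda u) xi u sg >= 1,
      forall u sg, sg \in Lambda u ->
        xi u sg - \sum_(l in Omega D) beta u l sg * theta l <= 0,
      forall l, l \in Omega D -> 0 <= theta l,
      forall s, s \in swaps D -> 0 <= omega s
    & forall u sg, sg \in Lambda u -> 0 <= xi u sg].

Definition sf_objective
    (theta : C -> R) (omega : N * N -> R) (xi : N -> R -> R) : R :=
  \sum_(l in Omega D) cost D l * theta l
  + \sum_(s in swaps D) rho D s * omega s
  - \sum_(u : N) \sum_(sg <- Lambda u) sg * xi u sg.

Definition sf_optimal
    (theta : C -> R) (omega : N * N -> R) (xi : N -> R -> R) : Prop :=
  sf_feasible theta omega xi /\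
  forall theta' omega' xi', sf_feasible theta' omega' xi' ->
    sf_objective theta omega xi <= sf_objective theta' omega' xi'.

End SfDoi.

(* Main.v *)
(* Any feasible point (theta, omega, xi) is dominated by a point with
   omega = 0 and xi = 0, so a minimizer of the unstabilized program is optimal.
   The rebates xi are traded for removals: each column l gets an amount x u l
   of removals of each item u, and the set of all items with x u l <> 0 is
   removed at once, because a modified column may lose its rebates. Swaps are
   handled by taking, among the points of no larger cost, one minimizing the
   sum of omega. If it is nonzero, either two consecutive swaps can be merged
   (or cancelled when they form a 2-cycle), or some omega (u, v) > 0 has no swap
   into u and none out of v. Then u is covered in excess: either a used column
   covers u and not v and can be swapped, or every used column covering u also
   covers v, so v is in excess too and u may be dropped from such a column by
   first removing v and then swapping u for v. Minima are attained over any
   ordered field because a bounded linear program has finitely many candidate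
   values. *)
Require Import Defs.
From mathcomp Require Import all_boot all_order all_algebra.
From mathcomp Require Import ring lra.
From Stdlib Require Import Classical_Prop.
Import Order.TTheory GRing.Theory Num.Theory.
Local Open Scope ring_scope.

Set Implicit Arguments.
Unset Strict Implicit.
Unset Printing Implicit Defensive.

(** * Attainment of minima of affine functions on polyhedra over an ordered field *)

Section Polyhedron.
Variables (R : realFieldType) (J : Type).

Definition line (x y : J -> R) (t : R) : J -> R :=
  fun j => x j + t * (y j - x j).

(** Being affine is tested only along lines through two points, which is all that the arguments on
    rays require. *)
Definition affine (g : (J -> R) -> R) : Prop :=
  forall x y t, g (line x y t) = g x + t * (g y - g x).

Lemma affine_coord j : affine (fun x => x j).
Proof. by []. Qed.

Lemma affine_cst a : affine (fun=> a).
Proof. by move=> x y t; ring. Qed.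

Lemma affineD g h : affine g -> affine h -> affine (fun x => g x + h x).
Proof. by move=> ag ah x y t; rewrite ag ah; ring. Qed.

Lemma affineZ a g : affine g -> affine (fun x => a * g x).
Proof. by move=> ag x y t; rewrite ag; ring. Qed.

Lemma affineB g h : affine g -> affine h -> affine (fun x => g x - h x).
Proof. by move=> ag ah x y t; rewrite ag ah; ring. Qed.

Lemma affine_sum (T : finType) (A : {set T}) (g : T -> (J -> R) -> R) :
  (forall k, affine (g k)) -> affine (fun x => \sum_(k in A) g k x).
Proof.
move=> ag x y t; rewrite -sumrB mulr_sumr -big_split /=.
by apply: eq_bigr => k _; rewrite ag.
Qed.

Variables (I : finType) (g : I -> (J -> R) -> R) (f : (J -> R) -> R).
Hypothesis affine_g : forall i, affine (g i).
Hypothesis affine_f : affine f.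

Definition poly x := forall i, 0 <= g i x.
Definition slack x : {set I} := [set i | 0 < g i x].
(** The points [y] of [poly] with [slack y \subset slack x] form the smallest face containing [x]:
    every constraint tight at [x] is tight there. *)
Definition face_min x :=
  poly x /\ forall y, poly y -> slack y \subset slack x -> f x <= f y.

Hypothesis bounded_f : exists m, forall x, poly x -> m <= f x.

(** Follow the ray from [x] through [y], along which [f] decreases. If no constraint decreases, the
    ray stays in the polyhedron and [f] is unbounded below. Otherwise stop where a first constraint
    becomes tight; those tight at [x] are tight at [y] too and remain so. *)
Lemma poly_face_step x y : poly x -> poly y -> slack y \subset slack x ->
  f y < f x ->
  exists z, [/\ poly z, slack z \proper slack x & f z <= f x].
Proof.
move=> px py yx fyx.
have [/existsP[i0 di0]|] := boolP [exists i, g i y < g i x]; last first.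
  rewrite negb_exists => /forallP nd; exfalso.
  have [m mP] := bounded_f.
  have ray t : 0 <= t -> poly (line x y t).
    move=> t0 i; rewrite affine_g addr_ge0 // mulr_ge0 // subr_ge0.
    by rewrite leNgt nd.
  have mx := mP _ px.
  (* This parameter brings the value of [f] on the ray to [m - 1], below the lower bound. *)
  pose t := (f x - m + 1) / (f x - f y).
  have d0 : 0 < f x - f y by rewrite subr_gt0.
  have t0 : 0 <= t by rewrite divr_ge0 ?(ltW d0) //; lra.
  have := mP _ (ray t t0); rewrite affine_f.
  have -> : t * (f y - f x) = - (f x - m + 1).
    by rewrite /t -(opprB (f x)) mulrN divfK // gt_eqF.
  by lra.
(* Ratio test: [r i] is the parameter at which the decreasing constraint [i] becomes tight, and the
   least one is selected. *)
pose r i := g i x / (g i x - g i y).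
case: (@Order.TotalTheory.arg_minP _ _ _ i0 (fun i => g i y < g i x) r di0)
  => i di ri.
have dpos k : g k y < g k x -> 0 < g k x - g k y by rewrite subr_gt0.
have r1 : 1 <= r i.
  by rewrite /r ler_pdivlMr ?dpos // mul1r; have := py i; lra.
exists (line x y (r i)); split.
- move=> k; rewrite affine_g.
  have [dk|dk] := ltP (g k y) (g k x).
    have := ri k dk; rewrite {2}/r ler_pdivlMr ?dpos //.
    by lra.
  by rewrite addr_ge0 // mulr_ge0 ?subr_ge0 //; lra.
- apply/properP; split; last first.
    exists i; first by rewrite inE; have := py i; lra.
    rewrite inE affine_g -(opprB (g i x)) mulrN divfK ?gt_eqF ?dpos //.
    by rewrite subrr ltxx.
  apply/subsetP => k; rewrite !inE affine_g => zk.
  rewrite lt_neqAle px andbT eq_sym; apply/eqP => xk.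
  have yk : g k y = 0.
    apply: le_anti; rewrite py andbT leNgt; apply/negP => yk.
    by have := subsetP yx k; rewrite !inE yk xk ltxx => /(_ isT).
  by move: zk; rewrite xk yk subrr mulr0 addr0 ltxx.
- rewrite affine_f gerDl mulr_ge0_le0 //; lra.
Qed.

(** Iterating [poly_face_step] strictly shrinks the slack set, so it ends, and it can only end at a
    face minimizer. *)
Lemma face_min_below x : poly x -> exists z, face_min z /\ f z <= f x.
Proof.
have [n] := ubnP #|slack x|; elim: n x => // n IHn x ltn px.
have [[y [py yx fyx]]|no] :=
  classic (exists y, [/\ poly y, slack y \subset slack x & f y < f x]).
  have [z [pz zx fzx]] := poly_face_step px py yx fyx.
  have [|w [mw fwz]] := IHn z _ pz.
    by rewrite (leq_trans (proper_card zx)).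
  by exists w; split=> //; apply: le_trans fzx.
exists x; split=> //; split=> // y py yx.
by rewrite leNgt; apply/negP => fyx; apply: no; exists y.
Qed.

Lemma face_min_eq x y : face_min x -> face_min y -> slack x = slack y ->
  f x = f y.
Proof.
move=> [px mx] [py my] e; apply: le_anti; apply/andP; split.
  by apply: mx; rewrite // e.
by apply: my; rewrite // e.
Qed.

(* The value of a face minimizer depends only on its slack set, so face
   minimizers take finitely many values. *)
Lemma poly_min_attained : (exists x, poly x) ->
  exists2 z, poly z & forall y, poly y -> f z <= f y.
Proof.
case=> x0 /face_min_below[z0 [mz0 _]].
(* By induction on the list of slack sets: minimizers sharing a slack set share their value, so one
   comparison per slack set suffices. *)
have H (s : seq {set I}) : exists z, face_min z /\
    forall y, face_min y -> slack y \in s -> f z <= f y.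
  elim: s => [|S s [z [mz zP]]]; first by exists z0.
  have [[y [my yS fyz]]|no] :=
    classic (exists y, [/\ face_min y, slack y = S & f y < f z]).
    exists y; split=> // w mw; rewrite inE => /predU1P[wS|ws].
      by rewrite (face_min_eq my mw) // yS.
    exact: le_trans (ltW fyz) (zP w mw ws).
  exists z; split=> // w mw; rewrite inE => /predU1P[wS|]; last exact: zP.
  by rewrite leNgt; apply/negP => fwz; apply: no; exists w.
have [z [[pz mz] zP]] := H (enum {: {set I}}).
exists z => // y /face_min_below[w [mw fwy]].
by apply: le_trans fwy; apply: zP; rewrite ?mem_enum.
Qed.

End Polyhedron.

(** * Changing a finite family at one index *)

Section Shift.
Variables (R : realFieldType) (T : finType).
Implicit Types (f F : T -> R) (A : {set T}).

Definition shift f a t : T -> R := fun x => f x + (x == a)%:R * t.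

Lemma sum_shift A F f a t : a \in A ->
  \sum_(x in A) F x * shift f a t x = \sum_(x in A) F x * f x + F a * t.
Proof.
move=> aA; rewrite /shift; under eq_bigr do rewrite mulrDr.
rewrite big_split /=; congr (_ + _).
rewrite (bigD1 a) //= eqxx mul1r big1 ?addr0 // => x /andP[_ /negPf ->].
by rewrite mul0r mulr0.
Qed.

Lemma sum_shift1 A f a t : a \in A ->
  \sum_(x in A) shift f a t x = \sum_(x in A) f x + t.
Proof.
move=> aA; have := sum_shift (fun=> 1) f t aA.
by rewrite mul1r; under eq_bigr do rewrite mul1r;
   under [in RHS]eq_bigr do rewrite mul1r.
Qed.

Lemma shift_ge0 A f a t : (forall x, x \in A -> 0 <= f x) -> - t <= f a ->
  forall x, x \in A -> 0 <= shift f a t x.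
Proof.
move=> f0 ta x xA; rewrite /shift; case: eqP => [->|_]; first by rewrite mul1r; lra.
by rewrite mul0r addr0 f0.
Qed.

End Shift.

(** * The intermediate program with columns and swaps but no rebates *)

Section SfDoiTheory.
Variables (R : realFieldType) (N C : finType) (D : sfdoi R N C).
Implicit Types (theta : C -> R) (omega : N * N -> R) (u v w : N) (l : C).

Definition coverage theta u : R := \sum_(l in Omega D) acoef D u l * theta l.

(** A single sum with signed coefficients, so that [sum_shift] applies directly; [net_inflowE]
    recovers the two sums of the program. *)
Definition net_inflow omega u : R :=
  \sum_(s in swaps D) ((s.2 == u)%:R - (s.1 == u)%:R) * omega s.

Definition swap_feasible theta omega : Prop :=
  [/\ forall u, 1 <= coverage theta u + net_inflow omega u,
      forall l, l \in Omega D -> 0 <= theta l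
    & forall s, s \in swaps D -> 0 <= omega s].

Definition swap_objective theta omega : R :=
  \sum_(l in Omega D) cost D l * theta l
  + \sum_(s in swaps D) rho D s * omega s.

Lemma net_inflowE omega u : net_inflow omega u =
  \sum_(s in swaps D | s.2 == u) omega s
  - \sum_(s in swaps D | s.1 == u) omega s.
Proof.
rewrite /net_inflow !big_mkcondr -sumrB; apply: eq_bigr => s _.
by case: (s.2 == u); case: (s.1 == u) => /=; ring.
Qed.

Hypotheses
  (hswap : swap_spec D) (hremove : remove_spec D)
  (hirr : swaps_irreflexive D) (hswapF : swaps_feasible D)
  (hrho : rho_bound D) (htri : rho_triangle D)
  (hsigma_ge0 : sigma_ge0 D) (hsigma_unc : sigma_uncovered D)
  (hrebate : rebate_property D (Omega D)).

(** * Coverage and cost of swapped and reduced columns *)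

Lemma covers_swap s l w : s \in swaps D -> l \in swappable D s ->
  covers D w (swap D l s) = (w == s.2) || (w != s.1) && covers D w l.
Proof. by move=> sS ls; have /setP/(_ w) := hswap (hirr sS) ls; rewrite !inE. Qed.

Lemma covers_remove l (S : {set N}) w : l \in Omega D -> S \subset items D l ->
  covers D w (remove D l S) = (w \notin S) && covers D w l.
Proof. by move=> lO Sl; have /setP/(_ w) := hremove lO Sl; rewrite !inE. Qed.

Lemma acoef_swap s l w : s \in swaps D -> l \in swappable D s ->
  acoef D w (swap D l s) = acoef D w l + (w == s.2)%:R - (w == s.1)%:R.
Proof.
move=> sS ls; rewrite /acoef covers_swap //; have := hirr sS.
move: ls; rewrite inE => /and3P[_ l1 /negPf l2] s12.
have [->|w2] /= := eqVneq w s.2; first by rewrite eq_sym (negPf s12) l2 /=; ring.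
by have [->|w1] /= := eqVneq w s.1; rewrite ?l1 /=; ring.
Qed.

Lemma acoef_remove l (S : {set N}) w : l \in Omega D -> S \subset items D l ->
  acoef D w (remove D l S) = acoef D w l - (w \in S)%:R.
Proof.
move=> lO Sl; rewrite /acoef covers_remove //.
case wS: (w \in S) => /=; last by rewrite subr0.
by have := subsetP Sl w wS; rewrite inE => ->; rewrite subrr.
Qed.

Lemma cost_remove l (S : {set N}) : l \in Omega D -> S \subset items D l ->
  cost D (remove D l S) <= cost D l.
Proof.
move=> lO Sl; have [_ h] := hrebate lO Sl.
by rewrite -subr_ge0; apply: le_trans h; apply: sumr_ge0 => u _; apply: hsigma_ge0.
Qed.

(** Take a cheapest column on which [u] can be swapped for [v]. Swapping there and back gives
    another such column, hence no cheaper, while the two penalties bound the total change of cost.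
    Minimality is used because the column obtained may differ from the initial one, even though it
    covers the same items. *)
Lemma rho_cycle_ge0 u v l : l \in Omega D -> covers D u l ->
  (u, v) \in swaps D -> (v, u) \in swaps D ->
  0 <= rho D (u, v) + rho D (v, u).
Proof.
move=> lO lu uvS vuS; have /= uv := hirr uvS.
(* If [l] covers [v] as well, removing [v] makes it swappable. *)
have [l0 l0P] : exists l0, l0 \in swappable D (u, v).
  have [lv|lv] := boolP (covers D v l); last by exists l; rewrite inE /= lO lu.
  have Sl : [set v] \subset items D l by rewrite sub1set inE.
  exists (remove D l [set v]); rewrite inE /= (hrebate lO Sl).1 /=.
  by rewrite !covers_remove // !inE eqxx (negPf uv) lu.
case: (@Order.TotalTheory.arg_minP _ _ _ l0 [in swappable D (u, v)] (cost D) l0P)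
  => k kP kmin.
have k1P : swap D k (u, v) \in swappable D (v, u).
  by rewrite inE /= hswapF //= !covers_swap //= !eqxx (negPf uv).
have k2P : swap D (swap D k (u, v)) (v, u) \in swappable D (u, v).
  by rewrite inE /= hswapF //= !covers_swap //= !eqxx [v == u]eq_sym (negPf uv).
by have := kmin _ k2P; have := hrho uvS kP; have := hrho vuS k1P; lra.
Qed.

(** * Moving weight between columns, and elimination of swaps *)

Lemma coverage_shift theta l k (e : R) u : l \in Omega D -> k \in Omega D ->
  coverage (shift (shift theta l (- e)) k e) u =
  coverage theta u + (acoef D u k - acoef D u l) * e.
Proof. by move=> lO kO; rewrite /coverage !sum_shift //; ring. Qed.

Lemma shift_pair_ge0 theta l k (e : R) :
  (forall j, j \in Omega D -> 0 <= theta j) -> l \in Omega D -> 0 <= e -> e <= theta l ->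
  k \in Omega D ->
  forall j, j \in Omega D -> 0 <= shift (shift theta l (- e)) k e j.
Proof.
move=> t0 lO e0 el kO; have t1 : forall j, j \in Omega D -> 0 <= shift theta l (- e) j.
  by apply: shift_ge0; rewrite // opprK.
by apply: shift_ge0 => //; apply: le_trans (t1 _ kO); rewrite oppr_le0.
Qed.

Lemma coverage_gt0_ex theta u :
  (forall l, l \in Omega D -> 0 <= theta l) -> 0 < coverage theta u ->
  exists l, [/\ l \in Omega D, covers D u l & 0 < theta l].
Proof.
move=> t0 c0.
have [/existsP[l /and3P[]]|no] :=
  boolP [exists l, [&& l \in Omega D, covers D u l & 0 < theta l]].
  by exists l.
move: c0; rewrite /coverage big1 ?ltxx // => l lO.
move: no; rewrite negb_exists => /forallP/(_ l); rewrite lO /acoef /=.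
case: (covers D u l) => //=; rewrite ?mul0r // mul1r -leNgt => tl.
by apply: le_anti; rewrite tl t0.
Qed.

(** Take the amount [e] off both swaps. If [u = w] they cancel, and [rho_cycle_ge0] bounds the cost;
    otherwise [e] is rerouted through [(u, w)], which the triangle inequality makes no dearer. Net
    inflows are unchanged and the total of [omega] drops by at least [e]. *)
Lemma merge_transit theta omega u v w :
  (forall x, exists2 l, l \in Omega D & covers D x l) ->
  swap_feasible theta omega -> (u, v) \in swaps D -> (v, w) \in swaps D ->
  0 < omega (u, v) -> 0 < omega (v, w) ->
  exists omega', [/\ swap_feasible theta omega',
    swap_objective theta omega' <= swap_objective theta omega
    & \sum_(s in swaps D) omega' s < \sum_(s in swaps D) omega s].
Proof.
move=> hcov [fc ft fo] uvS vwS o1 o2.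
pose e := Order.min (omega (u, v)) (omega (v, w)).
have e0 : 0 < e by rewrite lt_min o1 o2.
have [e1 e2] : e <= omega (u, v) /\ e <= omega (v, w).
  by rewrite /e ge_min lexx ge_min lexx orbT.
pose o' := shift (shift omega (u, v) (- e)) (v, w) (- e).
have /= uv := hirr uvS; have /= vw := hirr vwS.
have o'0 s : s \in swaps D -> 0 <= o' s.
  apply: shift_ge0; first by apply: shift_ge0; rewrite // opprK.
  (* As [u != v], the pairs [(u, v)] and [(v, w)] differ, so the first shift leaves [omega (v, w)]
     intact. *)
  by rewrite opprK /shift xpair_eqE eq_sym (negPf uv) /= mul0r addr0.
have [uw|uw] := eqVneq u w.
  subst w; have [l lO lu] := hcov u.
  have r0 := rho_cycle_ge0 lO lu uvS vwS.
  exists o'; split.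
  - split=> // x; have := fc x; rewrite /net_inflow !sum_shift //=.
    by lra.
  - rewrite /swap_objective !sum_shift //=.
    have : 0 <= (rho D (u, v) + rho D (v, u)) * e by rewrite mulr_ge0 // ltW.
    by lra.
  - by rewrite !sum_shift1 //; lra.
have [uwS tri] := htri uvS vwS uw.
exists (shift o' (u, w) e); split.
- split=> //.
    move=> x; have := fc x; rewrite /net_inflow !sum_shift //=.
    by lra.
  apply: shift_ge0 => //; apply: le_trans (o'0 _ uwS); lra.
- rewrite /swap_objective !sum_shift //=.
  have : 0 <= (rho D (u, v) + rho D (v, w) - rho D (u, w)) * e.
    by rewrite mulr_ge0 ?subr_ge0 // ltW.
  by lra.
- by rewrite !sum_shift1 //; lra.
Qed.

(** With no flow into [u], the columns alone must cover [u] at least [1 + omega (u, v)] times. Part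
    of the swap can then be carried out on a used column, or be dropped together with the excess at
    [u]. *)
Lemma realize_swap theta omega u v :
  swap_feasible theta omega -> (u, v) \in swaps D -> 0 < omega (u, v) ->
  (forall s, s \in swaps D -> s.2 = u -> omega s = 0) ->
  (forall s, s \in swaps D -> s.1 = v -> omega s = 0) ->
  exists theta' omega', [/\ swap_feasible theta' omega',
    swap_objective theta' omega' <= swap_objective theta omega
    & \sum_(s in swaps D) omega' s < \sum_(s in swaps D) omega s].
Proof.
move=> [fc ft fo] uvS o1 inu outv; have /= uv := hirr uvS.
have netu : net_inflow omega u <= - omega (u, v).
  rewrite /net_inflow (bigD1 (u, v)) //= eqxx eq_sym (negPf uv) sub0r mulN1r.
  rewrite gerDl sumr_le0 // => s /andP[sS _].
  have [/(inu _ sS) ->|_] := eqVneq s.2 u; first by rewrite mulr0.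
  by rewrite sub0r mulNr oppr_le0 mulr_ge0 // fo.
have covu : 1 + omega (u, v) <= coverage theta u by have := fc u; lra.
have shift_omega l (e : R) : 0 < e -> e <= omega (u, v) ->
    forall s, s \in swaps D -> 0 <= shift omega (u, v) (- e) s.
  by move=> e0 eo; apply: shift_ge0; rewrite // opprK.
have [/existsP[l /and4P[lO lu lv tl]]|] := boolP [exists l,
    [&& l \in Omega D, covers D u l, ~~ covers D v l & 0 < theta l]].
  have ls : l \in swappable D (u, v) by rewrite inE lO /= lu lv.
  have kO := hswapF uvS ls.
  pose e := Order.min (omega (u, v)) (theta l).
  have e0 : 0 < e by rewrite lt_min o1 tl.
  have [e1 e2] : e <= omega (u, v) /\ e <= theta l.
    by rewrite /e ge_min lexx ge_min lexx orbT.
  exists (shift (shift theta l (- e)) (swap D l (u, v)) e),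
    (shift omega (u, v) (- e)); split.
  - split; [|exact: shift_pair_ge0 (ltW e0) _ _|exact: shift_omega].
    move=> x; rewrite coverage_shift // acoef_swap //=.
    rewrite /net_inflow sum_shift //= -/(net_inflow _ _).
    rewrite ![x == _]eq_sym; apply: le_trans (fc x) _; lra.
  - rewrite /swap_objective !sum_shift //=.
    have : 0 <= (rho D (u, v) - (cost D (swap D l (u, v)) - cost D l)) * e.
      by rewrite mulr_ge0 ?(ltW e0) // subr_ge0 hrho.
    by lra.
  - by rewrite !sum_shift1 //; lra.
(* Now every used column covering [u] covers [v], so [v] inherits the excess coverage of [u]. *)
rewrite negb_exists => /forallP nov.
have covv : coverage theta u <= coverage theta v.
  apply: ler_sum => l lO; have := nov l; rewrite lO /= /acoef.
  case: (covers D u l); case: (covers D v l); rewrite //= ?mul0r ?mul1r //.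
    by rewrite -leNgt.
  by move=> _; apply: ft.
have [|l [lO lu tl]] := coverage_gt0_ex ft (u := u); first by lra.
have lv : covers D v l by have := nov l; rewrite lO lu tl /= andbT negbK.
have Sl : [set v] \subset items D l by rewrite sub1set inE.
have rO := (hrebate lO Sl).1.
have rP : remove D l [set v] \in swappable D (u, v).
  by rewrite inE /= rO !covers_remove // !inE eqxx (negPf uv) lu.
have kO := hswapF uvS rP; set k := swap D _ _ in kO.
(* Removing [v] and then bringing it back in place of [u] loses [u] only. *)
have ak x : acoef D x k = acoef D x l - (x == u)%:R.
  by rewrite acoef_swap // acoef_remove // inE /=; ring.
have ck : cost D k - cost D l <= rho D (u, v).
  by have := hrho uvS rP; have := cost_remove lO Sl; rewrite -/k; lra.
pose e := Order.min (omega (u, v)) (theta l).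
have e0 : 0 < e by rewrite lt_min o1 tl.
have [e1 e2] : e <= omega (u, v) /\ e <= theta l.
  by rewrite /e ge_min lexx ge_min lexx orbT.
exists (shift (shift theta l (- e)) k e), (shift omega (u, v) (- e)); split.
- split; [|exact: shift_pair_ge0 (ltW e0) _ _|exact: shift_omega].
  move=> x; rewrite coverage_shift // ak.
  have [->|xv] := eqVneq x v; last first.
    rewrite /net_inflow sum_shift //= -/(net_inflow _ _).
    rewrite [v == x]eq_sym (negPf xv) [u == x]eq_sym sub0r.
    by apply: le_trans (fc x) _; lra.
  (* At [v] the inflow shrinks without compensation from the new column, but nothing leaves [v] and
     the columns already cover it enough. *)
  rewrite eq_sym (negPf uv) subr0 subrr mul0r addr0.
  have : 0 <= net_inflow (shift omega (u, v) (- e)) v.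
    apply: sumr_ge0 => s sS; have so := shift_omega l e e0 e1 s sS.
    have [sv|_] := eqVneq s.1 v; last by rewrite subr0 mulr_ge0.
    rewrite /shift (outv s sS sv); case: (s =P (u, v)) sv => [-> /= e_uv|_ _].
      by rewrite e_uv eqxx in uv.
    by rewrite mul0r addr0 mulr0 lexx.
  by lra.
- rewrite /swap_objective !sum_shift //=.
  have : 0 <= (rho D (u, v) - (cost D k - cost D l)) * e.
    by rewrite mulr_ge0 ?(ltW e0) // subr_ge0.
  by lra.
- by rewrite !sum_shift1 //; lra.
Qed.

Lemma swap_reduce theta omega s :
  (forall x, exists2 l, l \in Omega D & covers D x l) ->
  swap_feasible theta omega -> s \in swaps D -> 0 < omega s ->
  exists theta' omega', [/\ swap_feasible theta' omega',
    swap_objective theta' omega' <= swap_objective theta omega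
    & \sum_(s in swaps D) omega' s < \sum_(s in swaps D) omega s].
Proof.
move=> hcov ff; have [_ _ fo] := ff; case: s => u v uvS ouv.
have [/existsP[[[a b] c]]|] := boolP [exists t : N * N * N,
    [&& t.1 \in swaps D, (t.1.2, t.2) \in swaps D,
        0 < omega t.1 & 0 < omega (t.1.2, t.2)]].
  move=> /and4P[/= abS bcS oab obc].
  have [o' [? ? ?]] := merge_transit hcov ff abS bcS oab obc.
  by exists theta, o'.
(* Without two consecutive positive swaps, [omega (u, v) > 0] forces zero flow into [u] and out of
   [v]. *)
rewrite negb_exists => /forallP notr.
apply: (realize_swap ff uvS ouv) => -[a b] abS /= e; subst; apply: le_anti;
  rewrite fo // andbT leNgt; apply/negP => oab.
  by have := notr (a, u, v); rewrite /= abS uvS oab ouv.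
by have := notr (u, v, b); rewrite /= abS uvS oab ouv.
Qed.

(** Among the feasible points of no larger cost, one with least total [omega] exists; [swap_reduce]
    shows that its [omega] vanishes. *)
Lemma swap_eliminate theta omega :
  (forall x, exists2 l, l \in Omega D & covers D x l) ->
  swap_feasible theta omega ->
  exists2 theta', sc_feasible D theta' &
    sc_objective D theta' <= swap_objective theta omega.
Proof.
move=> hcov ff.
pose th (x : C + N * N -> R) := fun l => x (inl l).
pose om (x : C + N * N -> R) := fun s => x (inr s).
(* The indicators turn the sign constraints outside [Omega D] and [swaps D] into [0 <= 0]; the
   [unit] index carries the bound on the cost. *)
pose g (i : N + C + N * N + unit) (x : C + N * N -> R) : R :=
  match i with
  | inl (inl (inl u)) => coverage (th x) u + net_inflow (om x) u - 1
  | inl (inl (inr l)) => (l \in Omega D)%:R * th x l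
  | inl (inr s) => (s \in swaps D)%:R * om x s
  | inr _ => swap_objective theta omega - swap_objective (th x) (om x)
  end.
pose f (x : C + N * N -> R) := \sum_(s in swaps D) om x s.
have affZ (T : finType) (A : {set T}) (F : T -> R) (h : T -> C + N * N) :
    affine (fun x => \sum_(k in A) F k * x (h k)).
  by apply: affine_sum => k; apply/affineZ/affine_coord.
have ag i : affine (g i).
  case: i => [[[u|l]|s]|[]] /=.
  - apply: affineB; last exact: affine_cst.
    by apply: affineD; apply: affZ.
  - exact/affineZ/affine_coord.
  - exact/affineZ/affine_coord.
  - apply: affineB; first exact: affine_cst.
    by apply: affineD; apply: affZ.
have af : affine f by apply: affine_sum => k; apply: affine_coord.
have polyP x : poly g x <-> swap_feasible (th x) (om x) /\
    swap_objective (th x) (om x) <= swap_objective theta omega.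
  split=> [px|[[h1 h2 h3] h4]].
    split; last by have := px (inr tt); rewrite /= subr_ge0.
    split=> [u|l lO|s sS].
    - by have := px (inl (inl (inl u))); rewrite /= subr_ge0.
    - by have := px (inl (inl (inr l))); rewrite /= lO mul1r.
    - by have := px (inl (inr s)); rewrite /= sS mul1r.
  case=> [[[u|l]|s]|[]] /=; rewrite ?subr_ge0 //.
    by case: (boolP (l \in _)) => [/h2|_]; rewrite ?mul1r ?mul0r.
  by case: (boolP (s \in _)) => [/h3|_]; rewrite ?mul1r ?mul0r.
have [||z /polyP[fz oz] zmin] := @poly_min_attained R _ _ g f ag af.
- exists 0 => x /polyP[[_ _ o0] _]; exact: sumr_ge0.
- exists (fun j => match j with inl l => theta l | inr s => omega s end).
  by apply/polyP.
have [f1 f2 f3] := fz.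
have o0 s : s \in swaps D -> om z s = 0.
  move=> sS; apply: le_anti; rewrite f3 // andbT leNgt; apply/negP => os.
  have [t' [o' [ff' oo' lt']]] := swap_reduce hcov fz sS os.
  pose z' (j : C + N * N) := match j with inl l => t' l | inr s => o' s end.
  have /zmin : poly g z' by apply/polyP; split=> //; apply: le_trans oz.
  by rewrite leNgt => /negP; apply.
exists (th z).
  split=> // u; have := f1 u.
  by rewrite /net_inflow [X in _ + X]big1 ?addr0 // => s sS; rewrite o0 ?mulr0.
move: oz; rewrite /swap_objective [X in _ + X <= _]big1 ?addr0 //.
by move=> s sS; rewrite o0 ?mulr0.
Qed.

(** * Turning removal amounts into reduced columns *)

Lemma removal_eliminate theta (x : N -> C -> R) :
  (forall l, l \in Omega D -> 0 <= theta l) ->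
  (forall u l, l \in Omega D -> 0 <= x u l <= theta l) ->
  (forall u l, l \in Omega D -> x u l != 0 -> covers D u l) ->
  exists theta', [/\ forall l, l \in Omega D -> 0 <= theta' l,
    forall u, coverage theta' u = coverage theta u - \sum_(l in Omega D) x u l
    & sc_objective D theta' <= sc_objective D theta
        - \sum_u \sum_(l in Omega D) sigma D u l * x u l].
Proof.
(* Induction on the number of nonzero amounts. For a column [l], let [S] be its items with nonzero
   amount and [e] the least of these amounts. Moving weight [e] from [l] to [remove D l S] makes an
   amount vanish, and the saving covers the rebates on [S]. *)
have [n] := ubnP #|[set p : N * C | (p.2 \in Omega D) && (x p.1 p.2 != 0)]|.
elim: n theta x => // n IHn theta x ltn t0 xb xc.
have [/existsP[[u0 l] /andP[/= lO xl]]|] :=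
  boolP [exists p : N * C, (p.2 \in Omega D) && (x p.1 p.2 != 0)]; last first.
  rewrite negb_exists => /forallP no.
  have x0 u l : l \in Omega D -> x u l = 0.
    by move=> lO; have := no (u, l); rewrite /= lO /= negbK => /eqP.
  exists theta; split=> //.
    by move=> u; rewrite big1 ?subr0 // => l lO; rewrite x0.
  rewrite big1 ?subr0 // => u _; rewrite big1 // => l lO.
  by rewrite x0 // mulr0.
case: (@Order.TotalTheory.arg_minP _ _ _ u0 (fun u => x u l != 0) (x^~ l) xl)
  => u1 x1 umin.
set e := x u1 l in umin.
pose S := [set u | x u l != 0].
have Sl : S \subset items D l.
  by apply/subsetP => u; rewrite !inE; apply: xc.
have e0 : 0 < e by rewrite lt_neqAle eq_sym x1; case/andP: (xb u1 l lO).
have el : e <= theta l by case/andP: (xb u1 l lO).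
have [kO ck] := hrebate lO Sl; set k := remove D l S in kO ck.
pose x' u j := x u j - ((j == l) && (u \in S))%:R * e.
have sumx' (F : C -> R) u : \sum_(j in Omega D) F j * x' u j =
    \sum_(j in Omega D) F j * x u j - F l * ((u \in S)%:R * e).
  have := sum_shift F (x u) (- ((u \in S)%:R * e)) lO.
  rewrite mulrN => <-; apply: eq_bigr => j _; rewrite /shift /x'.
  by case: (j == l); case: (u \in S) => /=; ring.
have [||||t' [t'0 t'c t'o]] := IHn (shift (shift theta l (- e)) k e) x'.
- rewrite -ltnS; apply: leq_trans ltn; apply: proper_card.
  apply/properP; split; last first.
    exists (u1, l); rewrite !inE /= lO //= /x' eqxx inE x1 /= mul1r.
    by rewrite subrr eqxx.
  apply/subsetP => -[u j]; rewrite !inE /= => /andP[-> /=].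
  by apply: contraNneq => xuj; rewrite /x' inE;
    case: (j =P l) => [<-|_]; rewrite xuj ?eqxx /= mul0r subr0.
- exact: shift_pair_ge0 (ltW e0) _ _.
(* Every nonzero amount on [l] drops by [e], as does the weight of [l], so amounts stay below
   weights; the extra weight on [k] only helps. *)
- move=> u j jO; have /andP[x0 xt] := xb u j jO.
  have kj : 0 <= (j == k)%:R * e by rewrite mulr_ge0 // ltW.
  rewrite /x' /shift inE; have [jl|_] /= := eqVneq j l; last first.
    by rewrite !mul0r subr0 addr0 x0 /=; lra.
  subst j; have [->|xn] /= := eqVneq (x u l) 0.
    by rewrite !mul0r subr0 lexx /=; lra.
  by have := umin u xn; rewrite !mul1r => ?; apply/andP; split; lra.
- move=> u j jO h; apply: xc => //; apply: contraNneq h => xuj.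
  by rewrite /x' inE; case: (j =P l) => [<-|_]; rewrite xuj ?eqxx /= mul0r subr0.
have S1 u : \sum_(j in Omega D) x' u j =
    \sum_(j in Omega D) x u j - (u \in S)%:R * e.
  have := sumx' (fun=> 1) u; rewrite mul1r.
  by under eq_bigr do rewrite mul1r; under [in RHS]eq_bigr do rewrite mul1r.
exists t'; split=> //.
  move=> u; rewrite t'c S1 coverage_shift // acoef_remove //; ring.
apply: le_trans t'o _; rewrite /sc_objective !sum_shift //.
rewrite (eq_bigr _ (fun u _ => sumx' (sigma D u) u)).
rewrite sumrB.
have -> : \sum_u sigma D u l * ((u \in S)%:R * e) = (\sum_(u in S) sigma D u l) * e.
  rewrite mulr_suml [RHS]big_mkcond /=; apply: eq_bigr => u _.
  by case: (u \in S); rewrite ?mul1r ?mul0r ?mulr0.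
have : 0 <= (cost D l - cost D k - \sum_(u in S) sigma D u l) * e.
  by rewrite mulr_ge0 ?(ltW e0) // subr_ge0.
by lra.
Qed.

(* Splits [xi u sg] among the columns [l] with [sigma D u l = sg],
   proportionally to [theta l]. *)
Definition rebate_split theta (xi : N -> R -> R) u l : R :=
  if sigma D u l \in Lambda D u then
    theta l * (xi u (sigma D u l)
      / \sum_(j in Omega D) beta D u j (sigma D u l) * theta j)
  else 0.

(** * Distributing rebates over columns *)

Section RebateSplit.
Variables (theta : C -> R) (xi : N -> R -> R).
Hypotheses (theta_ge0 : forall l, l \in Omega D -> 0 <= theta l)
  (xi_ge0 : forall u sg, sg \in Lambda D u -> 0 <= xi u sg)
  (xi_le : forall u sg, sg \in Lambda D u ->
     xi u sg <= \sum_(l in Omega D) beta D u l sg * theta l).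

Lemma rebate_split_bounds u l : l \in Omega D ->
  0 <= rebate_split theta xi u l <= theta l.
Proof.
move=> lO; rewrite /rebate_split; case: ifP => sL; last by rewrite lexx theta_ge0.
have := xi_ge0 sL; have := xi_le sL; set B := \sum_(j in _) _ => xB x0.
(* Division by zero yields [0], so the share is [0] when no used column has this rebate. *)
have [B0|Bn] := eqVneq B 0; first by rewrite B0 invr0 !mulr0 lexx theta_ge0.
have Bp : 0 < B by rewrite lt_neqAle eq_sym Bn (le_trans x0).
have t0 := theta_ge0 lO.
rewrite mulr_ge0 ?divr_ge0 ?(ltW Bp) //= -[leRHS]mulr1.
by rewrite ler_wpM2l // ler_pdivrMr // mul1r.
Qed.

(** The weight [h] serves two purposes: the indicator of nonzero rebates for coverage, and the
    identity for cost. *)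
Lemma sum_rebate_split (h : R -> R) u :
  \sum_(l in Omega D) h (sigma D u l) * rebate_split theta xi u l =
  \sum_(sg <- Lambda D u) h sg * xi u sg.
Proof.
pose B sg := \sum_(j in Omega D) beta D u j sg * theta j.
transitivity (\sum_(l in Omega D) \sum_(sg <- Lambda D u)
    h sg * (xi u sg / B sg) * (beta D u l sg * theta l)).
  apply: eq_bigr => l lO; rewrite /rebate_split; case: ifP => sL.
    rewrite -/(B _) (bigD1_seq (sigma D u l)) ?undup_uniq //= big1 ?addr0.
      by rewrite /beta eqxx mul1r; ring.
    by move=> sg; rewrite /beta eq_sym => /negPf ->; rewrite mul0r mulr0.
  rewrite mulr0 big_seq big1 // => sg sgL; rewrite /beta.
  by case: eqP => [e|_]; [rewrite e sgL in sL | rewrite mul0r mulr0].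
rewrite exchange_big /= big_seq [RHS]big_seq; apply: eq_bigr => sg sL.
rewrite -mulr_sumr -/(B sg) -mulrA.
have := xi_ge0 sL; have := xi_le sL; rewrite -/(B sg) => xB x0.
have [B0|Bn] := eqVneq (B sg) 0; last by rewrite divfK.
(* If [B sg] is zero, then [xi u sg] is squeezed to zero and matches the default value of the
   division. *)
by congr (_ * _); rewrite B0 mulr0; apply: le_anti; rewrite x0 -B0 xB.
Qed.

End RebateSplit.

(** Rebates are converted to removals first, with [omega] untouched; the result is feasible for the
    program with swaps, to which [swap_eliminate] applies. *)
Lemma sf_dominated theta omega xi :
  (forall x, exists2 l, l \in Omega D & covers D x l) ->
  sf_feasible D theta omega xi ->
  exists2 theta', sc_feasible D theta' &
    sc_objective D theta' <= sf_objective D theta omega xi.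
Proof.
move=> hcov [fc fx ft fo fx0].
have xi_le u sg : sg \in Lambda D u ->
     xi u sg <= \sum_(l in Omega D) beta D u l sg * theta l.
  by move=> /fx; rewrite subr_le0.
pose y := rebate_split theta xi.
(* Columns not covering [u] have rebate 0, so only positive rebates may be
   turned into removals. *)
pose x u l := (sigma D u l != 0)%:R * y u l.
have [|u l lO|t' [t'0 t'c t'o]] := @removal_eliminate theta x ft.
- move=> u l lO; have := rebate_split_bounds ft fx0 xi_le u lO.
  by rewrite /x /y; case: (_ != 0); rewrite ?mul1r // mul0r lexx ft.
- apply: contraR => nc; rewrite /x (hsigma_unc lO nc) eqxx mul0r.
  by [].
have [|t ft' ot'] := @swap_eliminate t' omega hcov.
  split=> // u; rewrite t'c net_inflowE /x.
  rewrite (sum_rebate_split fx0 xi_le (fun sg => (sg != 0)%:R)).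
  have := fc u; rewrite -/(coverage theta u).
  (* Leaving out the zero rebates removes less coverage than [xi] does, so the covering constraints
     survive. *)
  have : \sum_(sg <- Lambda D u) (sg != 0)%:R * xi u sg <=
         \sum_(sg <- Lambda D u) xi u sg.
    rewrite big_seq [leRHS]big_seq; apply: ler_sum => sg sL.
    by case: (_ != 0); rewrite ?mul1r // mul0r fx0.
  by lra.
exists t => //; apply: le_trans ot' _.
have e : \sum_u \sum_(l in Omega D) sigma D u l * x u l =
    \sum_u \sum_(sg <- Lambda D u) sg * xi u sg.
  apply: eq_bigr => u _.
  rewrite -(sum_rebate_split fx0 xi_le (fun sg => sg)); apply: eq_bigr => l _.
  by rewrite /x; case: eqP => [->|_]; rewrite ?mul0r ?mul1r.
rewrite /swap_objective /sf_objective.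
by move: t'o; rewrite e /sc_objective; lra.
Qed.

(** * Attainment for the unstabilized program, and the conclusion *)

Lemma sc_attained : (exists theta, sc_feasible D theta) ->
  (exists m, forall theta, sc_feasible D theta -> m <= sc_objective D theta) ->
  exists2 theta, sc_feasible D theta &
    forall theta', sc_feasible D theta' ->
      sc_objective D theta <= sc_objective D theta'.
Proof.
move=> [t0 f0] [m mP].
pose g (i : N + C) (x : C -> R) : R :=
  match i with
  | inl u => coverage x u - 1
  | inr l => (l \in Omega D)%:R * x l
  end.
have affZ (F : C -> R) : affine (fun x => \sum_(k in Omega D) F k * x k).
  by apply: affine_sum => k; apply/affineZ/affine_coord.
have ag i : affine (g i).
  case: i => [u|l] /=; last exact/affineZ/affine_coord.
  by apply: affineB; [apply: affZ | apply: affine_cst].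
have polyP x : poly g x <-> sc_feasible D x.
  split=> [px|[h1 h2]].
    split=> [u|l lO]; first by have := px (inl u); rewrite /= subr_ge0.
    by have := px (inr l); rewrite /= lO mul1r.
  case=> [u|l] /=; rewrite ?subr_ge0 //; first exact: h1.
  by case: (boolP (l \in _)) => [/h2|_]; rewrite ?mul1r ?mul0r.
have [||z /polyP fz zmin] :=
  @poly_min_attained R _ _ g (sc_objective D) ag (affZ _).
- by exists m => x /polyP; apply: mP.
- by exists t0; apply/polyP.
by exists z => // y /polyP; apply: zmin.
Qed.

End SfDoiTheory.

Theorem proposition3 (R : realFieldType) (N C : finType) (D : sfdoi R N C)
  (hOmegaR : OmegaR D \subset Omega D)
  (hswap : swap_spec D)
  (hremove : remove_spec D)
  (hirr : swaps_irreflexive D)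
  (hswapF : swaps_feasible D)
  (hrho : rho_bound D)
  (htri : rho_triangle D)
  (hsigma_ge0 : sigma_ge0 D)
  (hsigma_unc : sigma_uncovered D)
  (hrebate : rebate_property D (Omega D))
  (hfeas : exists theta : C -> R, sc_feasible D theta)
  (hbdd : exists m : R, forall theta : C -> R,
     sc_feasible D theta -> m <= sc_objective D theta) :
  exists (theta : C -> R) (omega : N * N -> R) (xi : N -> R -> R),
    [/\ sf_optimal D theta omega xi,
        forall s, s \in swaps D -> omega s = 0
      & forall u sg, sg \in Lambda D u -> xi u sg = 0].
Proof.
(* Feasibility forces each item to lie in some feasible column, as cancelling 2-cycles requires. *)
have hcov u : exists2 l, l \in Omega D & covers D u l.
  have [t [tc t0]] := hfeas.
  have [|l [lO lu _]] := coverage_gt0_ex t0 (u := u); last by exists l.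
  exact: lt_le_trans ltr01 (tc u).
have [t [tc t0] tmin] := sc_attained hfeas hbdd.
exists t, (fun=> 0), (fun _ _ => 0); split=> //; split.
  split=> // [u|u sg _].
    by rewrite !big1_eq addr0 !subr0; apply: tc.
  rewrite sub0r oppr_le0 sumr_ge0 // => l lO.
  by rewrite mulr_ge0 ?t0 // /beta ler0n.
move=> t' o' x' ff'.
have [t2 f2 o2] := sf_dominated hswap hremove hirr hswapF hrho htri hsigma_ge0
  hsigma_unc hrebate hcov ff'.
rewrite /sf_objective [X in _ + X - _]big1 => [|s _]; last by rewrite mulr0.
rewrite [X in _ - X]big1 => [|u _]; last by rewrite big1 // => sg _; rewrite mulr0.
by rewrite addr0 subr0; apply: le_trans (tmin _ f2) o2.
Qed.
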